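(* Let $G$ be a finite bipartite planar graph, embedded in the plane, that has a perfect matching. For any face $F=(M_F,C_F)$ of $\mathcal{C}(G)$, the graph $G_F$ is bipartite.
   Context: An elementary cycle (elementary region) of the embedded planar graph $G=(V,E)$ is a cycle of $G$ bounding a single bounded face. A tiling of $G$ is a partition of $V$ into blocks each of which is either an edge of $G$ or the vertex set of an elementary cycle. The cubical matching complex $\mathcal{C}(G)$ has as faces the pairs $F=(M_F,C_F)$, with $C_F$ a set of pairwise vertex-disjoint elementary cycles and $M_F$ a perfect matching of $G$ minus the vertices of the cycles in $C_F$. The weak dual $G^\circ$ has the bounded regions of $G$ as vertices, two being adjacent iff they share an edge. $\mathcal{R}_F$ is the set of elementary regions of $G$ for which every second edge of the boundary cycle is contained in $M_F$, and $G_F$ is the subgraph of $G^\circ$ induced by $\mathcal{R}_F$. *)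

(* Defs.v *)
From HB Require Import structures.
From mathcomp Require Import all_boot all_order all_algebra.
From mathcomp Require Import all_classical all_reals all_analysis.

Set Implicit Arguments.
Unset Strict Implicit.
Unset Printing Implicit Defensive.

Import Order.TTheory GRing.Theory Num.Theory.
Import numFieldNormedType.Exports.

Local Open Scope classical_set_scope.
Local Open Scope ring_scope.

(* Graphs with a possibly infinite ambient type [V]: the weak dual has sets of
   points of the plane as vertices. *)
Record graph (V : Type) := Graph { vertices : set V; adj : V -> V -> Prop }.

Definition induced (V : Type) (H : graph V) (S : set V) : graph V :=
  Graph (vertices H `&` S) (fun u v => [/\ S u, S v & adj H u v]).

Definition bipartite (V : Type) (H : graph V) : Prop :=
  exists color : V -> bool, forall u v,
    vertices H u -> vertices H v -> adj H u v -> color u <> color v.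

Definition is_arc (R : realType) (p q : R * R) (A : set (R * R)) : Prop :=
  exists g : R -> R * R,
    [/\ {within `[0, 1], continuous g},
        {in `[0, 1] &, injective g},
        g 0 = p, g 1 = q & g @` `[0, 1] = A].

Definition edges (T : finType) (e : rel T) : {set {set T}} :=
  [set [set x.1; x.2] | x : T * T & e x.1 x.2]%SET.

(* A finite simple graph drawn in the plane: vertices are distinct points, each
   edge is an arc joining its ends, and the interior of an edge contains no
   vertex and no point of another edge. The value of [curve] on a set that is
   not an edge is irrelevant. *)
Record plane_graph (R : realType) (T : finType) := PlaneGraph {
  erel : rel T;
  erel_sym : symmetric erel;
  erel_irr : irreflexive erel;
  pos : T -> R * R;
  curve : {set T} -> set (R * R);
  pos_inj : injective pos;
  curve_arc : forall x y, erel x y ->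
    is_arc (pos x) (pos y) (curve [set x; y]%SET);
  curve_vertex : forall (A : {set T}) x, A \in edges erel ->
    curve A (pos x) -> x \in A;
  curve_meet : forall A B : {set T},
    A \in edges erel -> B \in edges erel -> A != B ->
    curve A `&` curve B `<=` [set pos x | x in [set x | x \in A :&: B]]
}.

Section PlaneGraph.
Variables (R : realType) (T : finType) (G : plane_graph R T).

Definition underlying : graph T := Graph [set: T] (fun x y => erel G x y).

Definition edge_set : {set {set T}} := edges (erel G).

Definition curves (B : {set {set T}}) : set (R * R) :=
  \bigcup_(A in [set A | A \in B]) curve G A.

Definition drawing : set (R * R) := range (pos G) `|` curves edge_set.

Definition face (f : set (R * R)) : Prop :=
  exists2 x, ~ drawing x & f = connected_component (~` drawing) x.

Definition bounded_region (f : set (R * R)) : Prop := face f /\ bounded_set f.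

Definition frontier (f : set (R * R)) : set (R * R) := closure f `\` f°.

Definition is_cycle (c : seq T) : bool := ucycleb (erel G) c && (2 < size c)%N.

(* In cyclic order: entry [i] joins the [i]-th vertex of [c] to the next one. *)
Definition cycle_edges (c : seq T) : seq {set T} :=
  [seq [set x; next c x]%SET | x <- c].

Definition bounds (c : seq T) (f : set (R * R)) : Prop :=
  [/\ is_cycle c, bounded_region f &
      frontier f = curves [set:: cycle_edges c]%SET].

(* As a subgraph, a cycle is identified with its set of edges. *)
Definition elementary_cycle (B : {set {set T}}) : Prop :=
  exists c f, bounds c f /\ B = [set:: cycle_edges c]%SET.

(* A perfect matching of the subgraph of [G] induced by [S]. *)
Definition perfect_matching (S : {set T}) (M : {set {set T}}) : bool :=
  (M \subset edge_set) && finset.partition M S.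

(* For a cycle [B] given by its edges, [cover B] is its set of vertices. *)
Definition cubical_face (F : {set {set T}} * {set {set {set T}}}) : Prop :=
  [/\ forall B, B \in F.2 -> elementary_cycle B,
      forall B B', B \in F.2 -> B' \in F.2 -> B != B' ->
        finset.cover B :&: finset.cover B' = finset.set0 &
      perfect_matching (~: \bigcup_(B in F.2) finset.cover B)%SET F.1].

Definition weak_dual : graph (set (R * R)) :=
  Graph bounded_region
    (fun f g => f <> g /\ exists A : {set T},
       [/\ A \in edge_set, curve G A `<=` frontier f
         & curve G A `<=` frontier g]).

(* Every second edge of [c] lies in [M]; [b] selects one of the two classes of
   edges of the cycle, which has even length as soon as [G] is bipartite. *)
Definition alternating (M : {set {set T}}) (c : seq T) : Prop :=
  exists b : bool, forall i, (i < size c)%N -> odd i = b ->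
    nth finset.set0 (cycle_edges c) i \in M.

Definition alternating_regions (F : {set {set T}} * {set {set {set T}}}) :
  set (set (R * R)) :=
  [set f | exists c, bounds c f /\ alternating F.1 c].

Definition face_graph (F : {set {set T}} * {set {set {set T}}}) :
  graph (set (R * R)) := induced weak_dual (alternating_regions F).

End PlaneGraph.

(* Main.v *)
(** Let [w(c, x)] be the angle swept around [x] by the closed curve that draws the
    cycle [c]. If [c] bounds the region [f], then [w(c, x)] is nonzero for [x] in
    [f] and zero for [x] outside the closure of [f]: otherwise some nontrivial
    combination of the angles around an inner and an outer point would have a
    continuous real lift on the frontier, by Tietze's theorem this lift would
    extend over [f], and the resulting map from the plane to the circle would
    have nonzero degree on large circles.

    If two regions [f] and [g] share an edge, traversed in the same direction by
    their cycles [c] and [c'], the difference of the two winding numbers does not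
    jump across that edge, so [w(c, f) = - w(c', g)]; if the directions are
    opposite, [w(c, f) = w(c', g)].

    In a bipartite graph all matching edges of an alternating cycle leave
    vertices of the same colour [k] and the other edges leave vertices of the
    opposite colour. Hence [f] and [g] traverse a shared edge in the same
    direction exactly when their values of [k] agree, and the sign of [w(c, f)]
    combined with [k] is a proper 2-colouring. *)

Require Import Defs.
From mathcomp Require Import all_boot all_order all_algebra.
From mathcomp Require Import all_classical all_reals all_analysis.
From mathcomp Require Import ring lra.

Set Implicit Arguments.
Unset Strict Implicit.
Unset Printing Implicit Defensive.

Import Order.TTheory GRing.Theory Num.Theory.
Import numFieldNormedType.Exports.

Local Open Scope classical_set_scope.
Local Open Scope ring_scope.

(** * Angles modulo [2 * pi] *)

Section Angles.
Variable R : realType.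
Implicit Types t s : R.

Definition eqangle t s := cos t = cos s /\ sin t = sin s.

Lemma eqangle_sym t s : eqangle t s -> eqangle s t.
Proof. by case. Qed.

Lemma eqangle_trans t s r : eqangle t s -> eqangle s r -> eqangle t r.
Proof. by rewrite /eqangle => -[-> ->]. Qed.

Lemma eqangleD t s t' s' :
  eqangle t s -> eqangle t' s' -> eqangle (t + t') (s + s').
Proof. by move=> [e1 e2] [e3 e4]; split; rewrite ?cosD ?sinD e1 e2 e3 e4. Qed.

Lemma eqangleN t s : eqangle t s -> eqangle (- t) (- s).
Proof. by move=> [e1 e2]; split; rewrite ?cosN ?sinN ?e1 ?e2. Qed.

Lemma eqangleB t s t' s' :
  eqangle t s -> eqangle t' s' -> eqangle (t - t') (s - s').
Proof. by move=> e e'; apply/eqangleD/eqangleN. Qed.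

Lemma eqangleMn t s n : eqangle t s -> eqangle (t *+ n) (s *+ n).
Proof.
by move=> e; elim: n => // n IH; rewrite !mulrSr; apply: eqangleD.
Qed.

Lemma eqangleMz t s (k : int) : eqangle t s -> eqangle (t *~ k) (s *~ k).
Proof.
move=> e; case: k => n; rewrite ?NegzE ?mulrNz -?pmulrn.
  exact: eqangleMn.
exact/eqangleN/eqangleMn.
Qed.

Lemma eqangle_2piz (k : int) : eqangle (pi *+ 2 *~ k) 0.
Proof.
rewrite -(mul0rz _ k); apply: eqangleMz; split.
  by rewrite cos2pi cos0.
by rewrite sin2pi sin0.
Qed.

(** The difference is reduced to [0, 2 pi), where cosine 1 leaves only 0: cosine is injective on
    [0, pi], and the other half is reflected by r -> 2 pi - r. *)
Lemma eqangle_int t s : eqangle t s -> exists k : int, t = s + pi *+ 2 *~ k.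
Proof.
move=> ets; suff [k] : exists k : int, t - s = pi *+ 2 *~ k.
  by exists k; rewrite -p addrC subrK.
have [] : eqangle (t - s) 0 by rewrite -(subrr s); apply: eqangleB.
move: (t - s) => {ets}u; rewrite cos0 sin0.
have pi2 : 0 < (pi : R) *+ 2 by rewrite mulrn_wgt0// pi_gt0.
pose k := Num.floor (u / (pi *+ 2)); pose r := u - pi *+ 2 *~ k.
have r0 : 0 <= r.
  by rewrite subr_ge0 -mulrzr mulrC -ler_pdivlMr// ge_floor.
have r1 : r < pi *+ 2.
  rewrite ltrBlDr -[X in X + _]mulr1 -mulrzr -mulrDr mulrC -ltr_pdivrMr//.
  by rewrite addrC -[1]/(1%:~R) -intrD floorD1_gt.
have [] : eqangle u r.
  rewrite -[in X in eqangle X](subr0 u); apply: eqangleB => //.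
  exact/eqangle_sym/eqangle_2piz.
move=> -> -> c1 _; exists k.
suff : r = 0 by move/subr0_eq.
have [rp|rp] := leP r pi.
  by apply: cos_inj; rewrite ?in_itv/= ?r0 ?rp ?lexx ?pi_ge0// c1 cos0.
have : pi *+ 2 - r = 0.
  apply: cos_inj; rewrite ?in_itv/= ?lexx ?pi_ge0//.
    by rewrite subr_ge0 (ltW r1)/= mulr2n -addrA gerDl subr_le0 ltW.
  by rewrite cos0 -c1 addrC cosD2pi cosN.
by move/subr0_eq => e; move: r1; rewrite -e ltxx.
Qed.

(** The candidates are plus and minus [acos (a / r)]; the sign of [b] decides. *)
Lemma exists_angle (a b : R) : 0 < a ^+ 2 + b ^+ 2 ->
  exists t, a = Num.sqrt (a ^+ 2 + b ^+ 2) * cos t /\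
            b = Num.sqrt (a ^+ 2 + b ^+ 2) * sin t.
Proof.
move=> ab0; set r := Num.sqrt _.
have r0 : 0 < r by rewrite sqrtr_gt0.
have r2 : r ^+ 2 = a ^+ 2 + b ^+ 2 by rewrite sqr_sqrtr// ltW.
have ar : -1 <= a / r <= 1.
  have h : `|a / r| <= 1.
    rewrite -(@ler_pXn2r _ 2) ?nnegrE// normrM normfV exprMn exprVn.
    rewrite !real_normK ?num_real// expr1n r2 ler_pdivrMr// mul1r.
    by rewrite lerDl sqr_ge0.
  by rewrite -ler_norml.
have e1 : cos (acos (a / r)) = a / r by rewrite acosK.
have e2 : sin (acos (a / r)) = `|b| / r.
  rewrite sin_acos//.
  have -> : 1 - (a / r) ^+ 2 = (b / r) ^+ 2.
    by rewrite !expr_div_n r2; field; rewrite gt_eqF.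
  by rewrite sqrtr_sqr normrM normfV (gtr0_norm r0).
have [b0|b0] := leP 0 b.
  exists (acos (a / r)); rewrite e1 e2 ger0_norm//.
  by split; field; rewrite gt_eqF.
exists (- acos (a / r)); rewrite cosN sinN e1 e2 ltr0_norm//.
by split; field; rewrite gt_eqF.
Qed.

(** For an angle with positive cosine this is the representative in (-pi/2, pi/2). It reads [t] only
    through sine and cosine, so it varies continuously even where [t] jumps by multiples of 2 pi. *)
Definition principal t := atan (tan t).

Lemma eqangle_principal t : 0 < cos t -> eqangle (principal t) t.
Proof.
move=> ct.
have cp : 0 < cos (principal t).
  by rewrite cos_gt0_pihalf// atan_gtNpi2 atan_ltpi2.
have tp : tan (principal t) = tan t by rewrite atanK.
have ec : cos (principal t) = cos t.
  apply: (@pexpIrn _ 2) => //; rewrite ?nnegrE ?ltW//.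
  by apply: invr_inj; rewrite !cos2_tan2 ?gt_eqF// tp.
split=> //; move: tp; rewrite /tan ec => /(congr1 ( *%R^~ (cos t))).
by rewrite !divfK// gt_eqF.
Qed.

(* Unspecified at the zero vector. *)
Definition vec_angle (v : R * R) : R :=
  get [set t | v.1 = Num.sqrt (v.1 ^+ 2 + v.2 ^+ 2) * cos t /\
               v.2 = Num.sqrt (v.1 ^+ 2 + v.2 ^+ 2) * sin t].

Lemma vec_angleP (v : R * R) : v != 0 ->
  [/\ 0 < Num.sqrt (v.1 ^+ 2 + v.2 ^+ 2),
   v.1 = Num.sqrt (v.1 ^+ 2 + v.2 ^+ 2) * cos (vec_angle v) &
   v.2 = Num.sqrt (v.1 ^+ 2 + v.2 ^+ 2) * sin (vec_angle v)].
Proof.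
move=> v0; have ab0 : 0 < v.1 ^+ 2 + v.2 ^+ 2.
  rewrite lt0r addr_ge0 ?sqr_ge0// paddr_eq0 ?sqr_ge0// !sqrf_eq0 andbT.
  by apply: contra v0; rewrite [v]surjective_pairing /= => /andP[/eqP-> /eqP->].
have [t ht] := exists_angle ab0.
by have [] := getPex (ex_intro (fun t => v.1 = Num.sqrt (v.1 ^+ 2 + v.2 ^+ 2) * cos t /\
   v.2 = Num.sqrt (v.1 ^+ 2 + v.2 ^+ 2) * sin t) t ht); rewrite sqrtr_gt0.
Qed.

Definition angle_from (x z : R * R) : R := vec_angle (z - x).

Lemma angle_from_circle x r t : 0 < r ->
  eqangle (angle_from x (x.1 + r * cos t, x.2 + r * sin t)) t.
Proof.
move=> r0; rewrite /angle_from; set v := (_ - x).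
have v1 : v.1 = r * cos t by rewrite /v /= addrC addKr.
have v2 : v.2 = r * sin t by rewrite /v /= addrC addKr.
have nv : Num.sqrt (v.1 ^+ 2 + v.2 ^+ 2) = r.
  by rewrite v1 v2 !exprMn -mulrDr cos2Dsin2 mulr1 sqrtr_sqr gtr0_norm.
have v0 : v != 0.
  apply/eqP => v0; move: nv; rewrite v0 /= expr0n/= addr0 sqrtr0 => r00.
  by move: r0; rewrite -r00 ltxx.
have [_] := vec_angleP v0; rewrite nv v1 v2.
by split; apply: (mulfI (lt0r_neq0 r0)).
Qed.

Lemma cos_angle_fromB_gt0 (x p z : R * R) : z != x -> z != p ->
  0 < (z.1 - x.1) * (z.1 - p.1) + (z.2 - x.2) * (z.2 - p.2) ->
  0 < cos (angle_from x z - angle_from p z).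
Proof.
rewrite -subr_eq0 => /vec_angleP[r0 r1 r2].
rewrite -subr_eq0 => /vec_angleP[s0 s1 s2].
have -> : (z.1 - x.1) = (z - x).1 by []. have -> : (z.2 - x.2) = (z - x).2 by [].
have -> : (z.1 - p.1) = (z - p).1 by []. have -> : (z.2 - p.2) = (z - p).2 by [].
move: r0 r1 r2 s0 s1 s2; rewrite -/(angle_from x z) -/(angle_from p z).
set a := Num.sqrt ((z - x).1 ^+ 2 + _); set b := Num.sqrt ((z - p).1 ^+ 2 + _).
move: a b => a b a0 -> -> b0 -> ->.
have -> : a * cos (angle_from x z) * (b * cos (angle_from p z)) +
  a * sin (angle_from x z) * (b * sin (angle_from p z)) =
  a * b * cos (angle_from x z - angle_from p z) by rewrite cosB; ring.
by rewrite pmulr_rgt0// mulr_gt0.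
Qed.

(** From outside the ball, the centre and a point of the half-size ball are seen under an acute
    angle: their dot product is bounded below coordinatewise. *)
Lemma cos_angle_fromB_near (x p z : R * R) (r : R) : 
  ball p (r / 2) x -> ~ ball p r z ->
  0 < cos (angle_from x z - angle_from p z).
Proof.
move=> px pz.
have r0 : 0 < r.
  by move: px => [+ _]; rewrite /ball/= => /(le_lt_trans (normr_ge0 _)); lra.
have zx : z != x.
  apply/eqP => zx; apply: pz; rewrite zx; apply: (le_ball _ px); lra.
have zp : z != p by apply/eqP => zp; apply: pz; rewrite zp; exact: ballxx.
apply: cos_angle_fromB_gt0 => //.
move: px => [/=]; rewrite /ball/= !ltr_norml => /andP[a1 a2] /andP[b1 b2].
have : ~ (`|p.1 - z.1| < r /\ `|p.2 - z.2| < r) by move=> h; apply: pz.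
move: a1 a2 b1 b2; rewrite !ltr_norml.
set a := p.1 - x.1; set b := p.2 - x.2; set c := p.1 - z.1; set d := p.2 - z.2.
have -> : z.1 - x.1 = a - c by rewrite /a /c; ring.
have -> : z.2 - x.2 = b - d by rewrite /b /d; ring.
have -> : z.1 - p.1 = - c by rewrite /c; ring.
have -> : z.2 - p.2 = - d by rewrite /d; ring.
move=> a1 a2 b1 b2 h.
have qa : - (r / 2 * `|c|) <= - (a * c) .
  rewrite lerN2 (le_trans (ler_norm _))// normrM ler_wpM2r// ltW//.
  by rewrite ltr_norml a1.
have qb : - (r / 2 * `|d|) <= - (b * d).
  rewrite lerN2 (le_trans (ler_norm _))// normrM ler_wpM2r// ltW//.
  by rewrite ltr_norml b1.
(* Balls are squares here (max norm), so leaving one means that some coordinate differs by at least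
   [r]. *)
have hcd : r <= `|c| \/ r <= `|d|.
  have [|hc] := leP r `|c|; first by left.
  have [|hd] := leP r `|d|; first by right.
  by case: h; rewrite -!ltr_norml.
have ec : c ^+ 2 = `|c| ^+ 2 by rewrite real_normK// num_real.
have ed : d ^+ 2 = `|d| ^+ 2 by rewrite real_normK// num_real.
have -> : (a - c) * - c + (b - d) * - d = - (a * c) - (b * d) + c ^+ 2 + d ^+ 2.
  by ring.
rewrite ec ed.
move: qa qb hcd; move: `|c| `|d| => {ec ed h} C D qa qb hcd.
(* The large coordinate contributes at least r^2/2, while the other loses at most r^2/16. *)
have key (A B : R) : r <= A -> 0 < A ^+ 2 - r / 2 * A + (B ^+ 2 - r / 2 * B).
  move=> rA; have : 0 <= (B - r / 4) ^+ 2 by rewrite sqr_ge0.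
  have : 0 <= (A - r) * (A + r / 2) by rewrite mulr_ge0//; lra.
  have : 0 < r * r by rewrite mulr_gt0.
  rewrite !expr2; nra.
by case: hcd => h; [have := key C D h|have := key D C h]; lra.
Qed.

End Angles.

Arguments principal {R}.
Arguments angle_from {R}.

(** * Lifts of circle-valued maps *)

Section AngularContinuity.
Variable R : realType.

(* Maps to the circle are represented by real functions considered modulo
   [2 * pi]; the representative itself need not be continuous. *)
Definition angular_continuous (X : topologicalType) (A : set X) (phi : X -> R) :=
  {within A, continuous (cos \o phi)} /\ {within A, continuous (sin \o phi)}.

Definition is_lift (X : topologicalType) (A : set X) (phi L : X -> R) :=
  {within A, continuous L} /\ forall z, A z -> eqangle (L z) (phi z).

Lemma within_continuous_comp (X Y Z : topologicalType) (A : set X) (B : set Y)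
    (f : X -> Y) (g : Y -> Z) :
  {within A, continuous f} -> (forall x, A x -> B (f x)) ->
  {within B, continuous g} -> {within A, continuous (g \o f)}.
Proof.
move=> /subspace_continuousP cf fAB /subspace_continuousP cg.
apply/subspace_continuousP => x Ax; apply: cvg_comp (cg _ (fAB _ Ax)).
move=> W /= /(cf x Ax) /=; rewrite /within/= !nbhs_simpl /= => h.
have h' : \forall y \near x, A y -> B (f y) -> W (f y) by exact: h.
by near=> y => Ay; apply: (near h' y) => //; exact: fAB.
Unshelve. all: by end_near. Qed.

Section Operations.
Variables (X : topologicalType) (A : set X).
Implicit Types (phi psi : X -> R).

Lemma eq_angular_continuous phi psi :
  (forall z, A z -> eqangle (phi z) (psi z)) ->
  angular_continuous A phi -> angular_continuous A psi.
Proof.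
move=> e [c s]; split.
  by apply: subspace_eq_continuous c => z; rewrite inE => /e[].
by apply: subspace_eq_continuous s => z; rewrite inE => /e[].
Qed.

Lemma continuous_angular_continuous phi :
  {within A, continuous phi} -> angular_continuous A phi.
Proof.
move=> cphi; split => z; apply: continuous_comp (cphi z) _.
  exact: continuous_cos.
exact: continuous_sin.
Qed.

Lemma angular_continuousD phi psi :
  angular_continuous A phi -> angular_continuous A psi ->
  angular_continuous A (fun z => phi z + psi z).
Proof.
move=> [c s] [c' s']; split.
  have -> : cos \o (fun z => phi z + psi z) = (fun z =>
    (cos \o phi) z * (cos \o psi) z - (sin \o phi) z * (sin \o psi) z).
    by apply: funext => z /=; rewrite cosD.
  move=> z; apply: cvgB; apply: cvgM;
    [exact: c|exact: c'|exact: s|exact: s'].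
have -> : sin \o (fun z => phi z + psi z) = (fun z =>
    (sin \o phi) z * (cos \o psi) z + (cos \o phi) z * (sin \o psi) z).
  by apply: funext => z /=; rewrite sinD.
by move=> z; apply: cvgD; apply: cvgM; [exact: s|exact: c'|exact: c|exact: s'].
Qed.

Lemma angular_continuousN phi :
  angular_continuous A phi -> angular_continuous A (fun z => - phi z).
Proof.
move=> [c s]; split.
  have -> // : cos \o (fun z => - phi z) = cos \o phi.
  by apply: funext => z /=; rewrite cosN.
have -> : sin \o (fun z => - phi z) = (fun z => - (sin \o phi) z).
  by apply: funext => z /=; rewrite sinN.
by move=> z; apply: cvgN; exact: s.
Qed.

Lemma angular_continuousB phi psi :
  angular_continuous A phi -> angular_continuous A psi ->
  angular_continuous A (fun z => phi z - psi z).
Proof. by move=> ? ?; apply/angular_continuousD/angular_continuousN. Qed.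

Lemma angular_continuousMz phi (k : int) :
  angular_continuous A phi -> angular_continuous A (fun z => phi z *~ k).
Proof.
move=> cphi.
have H n : angular_continuous A (fun z => phi z *+ n).
  elim: n => [|n IH]; last first.
    have -> : (fun z => phi z *+ n.+1) = (fun z => phi z + phi z *+ n).
      by apply: funext => z; rewrite mulrS.
    exact: angular_continuousD.
  apply: continuous_angular_continuous => z; exact: cvg_cst.
case: k => n; first exact: H.
have -> : (fun z => phi z *~ Negz n) = (fun z => - (phi z *+ n.+1)).
  by apply: funext => z; rewrite NegzE mulrNz.
exact: angular_continuousN.
Qed.

Lemma angular_continuousW (B : set X) phi : B `<=` A ->
  angular_continuous A phi -> angular_continuous B phi.
Proof. by move=> BA [c s]; split; apply: continuous_subspaceW BA _. Qed.

Lemma continuous_principal phi : angular_continuous A phi ->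
  (forall z, A z -> 0 < cos (phi z)) ->
  {within A, continuous (principal \o phi)}.
Proof.
move=> [c s] pos; rewrite continuous_subspace_in => z; rewrite inE => Az.
apply: (@continuous_comp (subspace A) R R (tan \o phi) atan z); last exact: continuous_atan.
apply: cvgM; first exact: s.
by apply: cvgV; [rewrite gt_eqF// pos|exact: c].
Qed.

(** This gives uniqueness of lifts up to a constant. All values are multiples of 2 pi; two distinct
    ones would force the intermediate value [psi z + pi], whose cosine is -1. *)
Lemma continuous_eqangle0_cst psi : connected A ->
  {within A, continuous psi} -> (forall z, A z -> eqangle (psi z) 0) ->
  forall z z', A z -> A z' -> psi z = psi z'.
Proof.
move=> cA cpsi e.
have H z z' : A z -> A z' -> ~ psi z < psi z'.
  move=> Az Az' lt.
  have /connected_intervalP itv := connected_continuous_connected cA cpsi.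
  have [k ek] := eqangle_int (e z Az).
  have [k' ek'] := eqangle_int (e z' Az').
  have pi2 : 0 < (pi : R) *+ 2 by rewrite mulrn_wgt0// pi_gt0.
  have kk : (k < k')%R.
    by move: lt; rewrite ek ek' !add0r -(mulrzr _ k) -(mulrzr _ k') ltr_pM2l// ltr_int.
  have : (psi @` A) (psi z + pi).
    apply: (itv (psi z) (psi z')); [by exists z|by exists z'|].
    rewrite lerDl pi_ge0/= ek ek' !add0r.
    apply: (@le_trans _ _ (pi *+ 2 *~ (k + 1))).
      by rewrite mulrzDr lerD2l mulr1z mulr2n lerDl pi_ge0.
    by rewrite -(mulrzr _ (k + 1)) -(mulrzr _ k') ler_pM2l// ler_int -ltzD1 ltrD2r.
  move=> [y Ay ey]; have [+ _] := e y Ay; rewrite ey cosDpi.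
  by have [-> _] := e z Az; rewrite cos0; lra.
move=> z z' Az Az'; have [||//] := ltgtP (psi z) (psi z') => h.
  by case: (H _ _ Az Az').
by case: (H _ _ Az' Az).
Qed.

End Operations.

Lemma angular_continuousU (X : topologicalType) (A B : set X) (phi : X -> R) :
  closed A -> closed B ->
  angular_continuous A phi -> angular_continuous B phi ->
  angular_continuous (A `|` B) phi.
Proof. by move=> cA cB [c s] [c' s']; split; apply: withinU_continuous. Qed.

Lemma angular_continuous_comp (X Y : topologicalType) (A : set X) (B : set Y)
    (f : X -> Y) (phi : Y -> R) :
  {within A, continuous f} -> (forall x, A x -> B (f x)) ->
  angular_continuous B phi -> angular_continuous A (phi \o f).
Proof.
move=> cf fAB [c s]; split; first exact: (within_continuous_comp cf fAB c).
exact: (within_continuous_comp cf fAB s).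
Qed.

Lemma angular_continuous_angle_from (A : set (R * R)) (x : R * R) :
  ~ A x -> angular_continuous A (angle_from x).
Proof.
move=> Ax.
pose n (z : R * R) : R := Num.sqrt ((z - x).1 ^+ 2 + (z - x).2 ^+ 2).
have zx z : A z -> z - x != 0.
  by move=> Az; rewrite subr_eq0; apply/eqP => zx; apply: Ax; rewrite -zx.
have c1 : continuous (fun z : R * R => (z - x).1).
  by move=> z; apply: cvgB; [exact: cvg_fst|exact: cvg_cst].
have c2 : continuous (fun z : R * R => (z - x).2).
  by move=> z; apply: cvgB; [exact: cvg_snd|exact: cvg_cst].
have cn : continuous n.
  move=> z; apply: (@continuous_comp (R * R)%type R R
    (fun z => (z - x).1 ^+ 2 + (z - x).2 ^+ 2) (@Num.sqrt R));
    last exact: sqrt_continuous.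
  by apply: cvgD; rewrite expr2; apply: cvgM; first [exact: c1|exact: c2].
have W (f : R * R -> R) : continuous f ->
    {within A, continuous (fun z => f z / n z)}.
  move=> cf; apply: continuous_in_subspaceT => z; rewrite inE => Az.
  apply: cvgM; first exact: cf.
  by apply: cvgV; [have [] := vec_angleP (zx _ Az); rewrite lt0r => /andP[]|exact: cn].
split.
  apply: subspace_eq_continuous (W _ c1) => z; rewrite inE => /zx h.
  suff : (z - x).1 / n z = cos (vec_angle (z - x)) by [].
  have [r0 r1 r2] := vec_angleP h.
  by rewrite /n {1}r1 mulrAC divff ?mul1r// gt_eqF.
apply: subspace_eq_continuous (W _ c2) => z; rewrite inE => /zx h.
suff : (z - x).2 / n z = sin (vec_angle (z - x)) by [].
have [r0 r1 r2] := vec_angleP h.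
by rewrite /n {1}r2 mulrAC divff ?mul1r// gt_eqF.
Qed.

(** Uniform continuity modulo 2 pi: the cosine of the increment is continuous and equals 1 on the
    diagonal, and compactness makes the radius uniform. *)
Lemma compact_angle_increments (V : normedModType R) (K : set V) (phi : V -> R) :
  compact K -> angular_continuous setT phi ->
  exists2 d : R, 0 < d & forall x y, K x -> ball x d y ->
    0 < cos (phi y - phi x).
Proof.
move=> /compact_near_coveringP cK [c0 s0].
have c : continuous (cos \o phi) by apply/continuous_subspace_setT.
have s : continuous (sin \o phi) by apply/continuous_subspace_setT.
have : \forall d \near (0 : R)^'+, K `<=` [set x | forall y, ball x d y ->
    0 < cos (phi y - phi x)].
  apply: cK => x Kx.
  pose g (u : V * V) := cos (phi u.1 - phi u.2).
  have cg : {for (x, x), continuous g}.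
    have -> : g = (fun u : V * V => (cos \o phi) u.1 * (cos \o phi) u.2 +
        (sin \o phi) u.1 * (sin \o phi) u.2).
      by apply: funext => u; rewrite /g cosB.
    have f1 (h : V -> R) : continuous h -> {for (x, x), continuous (fun u : V * V => h u.1)}.
      by move=> ch; apply: (continuous_comp cvg_fst); exact: ch.
    have f2 (h : V -> R) : continuous h -> {for (x, x), continuous (fun u : V * V => h u.2)}.
      by move=> ch; apply: (continuous_comp cvg_snd); exact: ch.
    by apply: cvgD; apply: cvgM;
      [exact (f1 _ c)|exact (f2 _ c)|exact (f1 _ s)|exact (f2 _ s)].
  have g0 : 0 < g (x, x) by rewrite /g subrr cos0.
  have /nbhs_ballP[r /= r0 hr] : nbhs (x, x) [set u | 0 < g u].
    exact: (cvgr_gt _ cg).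
  exists (ball x (r / 2), [set d | d < r / 2]).
    split; first by apply: nbhsx_ballx; rewrite divr_gt0.
    by apply: nbhs_right_lt; rewrite divr_gt0.
  move=> [x' d] [/= xx' dr] y xy.
  apply: (hr (y, x')); split => /=.
    apply: (@le_ball _ _ _ (r / 2 + d)); first by lra.
    exact: ball_triangle xx' xy.
  by apply: (@le_ball _ _ _ (r / 2)) => //; lra.
move=> H; have [d [d0 hd]] : exists d : R, 0 < d /\ (K `<=` [set x | forall y, ball x d y ->
    0 < cos (phi y - phi x)]).
  have P : (0 : R)^'+ (fun d => 0 < d /\ (K `<=` [set x | forall y, ball x d y ->
    0 < cos (phi y - phi x)])).
    near=> d; split; last exact: (near H d).
    by near: d; exact: nbhs_right_gt.
  exact: (filter_ex P).
by exists d => // x y Kx; exact: hd.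
Unshelve. all: by end_near. Qed.

(* Adding up the principal values of the small increments of [phi] along the
   segment from [0] to [z] gives a lift that depends continuously on [z]. *)
Lemma starshaped_lift (V : normedModType R) (K : set V) (phi : V -> R) :
  compact K -> (forall z (s : R), K z -> 0 <= s <= 1 -> K (s *: z)) ->
  angular_continuous setT phi -> exists L, is_lift K phi L.
Proof.
move=> cK star cphi.
have [d d0 hd] := compact_angle_increments cK cphi.
have [B [Breal hB]] := compact_bounded cK.
have {}hB z : K z -> `|z| <= `|B| + 1.
  by move=> Kz; apply: hB => //; rewrite (le_lt_trans (ler_norm _))// ltrDl.
(* With [N] steps, consecutive division points of the segment from 0 to a point of [K] are closer
   than [d]. *)
pose N := (Num.trunc ((`|B| + 1) / d)).+1.
have N0 : 0 < N%:R :> R by rewrite ltr0n.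
have BN : (`|B| + 1) / N%:R < d.
  rewrite ltr_pdivrMr// mulrC -ltr_pdivrMr// truncnS_gt//.
pose step (k : nat) (z : V) := phi ((k.+1%:R / N%:R) *: z) - phi ((k%:R / N%:R) *: z).
have step_gt0 k z : (k < N)%N -> K z -> 0 < cos (step k z).
  move=> kN Kz; apply: hd.
    by apply: star => //; rewrite divr_ge0//= ler_pdivrMr// mul1r ler_nat ltnW.
  rewrite -ball_normE /= -scalerBl -mulrBl -opprB -natrB// subSnn.
  rewrite mulNr normrZ normrN mul1r normfV ger0_norm ?ler0n// mulrC.
  by apply: le_lt_trans BN; rewrite ler_pM2r ?invr_gt0//; exact: hB.
have cstep k : angular_continuous setT (step k).
  by apply: angular_continuousB; apply: (@angular_continuous_comp _ _ _ setT) => //;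
    apply: continuous_subspaceT; exact: scaler_continuous.
exists (fun z => phi 0 + \sum_(k < N) principal (step k z)); split.
  move=> z; apply: cvgD; first exact: cvg_cst.
  apply: cvg_big => [|k _]; first exact: add_continuous.
  apply: (@continuous_principal _ K (step k)) => [|y Ky]; last exact: step_gt0.
  exact: angular_continuousW (cstep k).
move=> z Kz.
have -> : phi z = phi 0 + \sum_(k < N) step k z.
  rewrite -(big_mkord xpredT (fun k => step k z)) /step.
  by rewrite (telescope_sumr (fun k => phi ((k%:R / N%:R) *: z)))// divff ?gt_eqF//
    scale1r mul0r scale0r addrC subrK.
apply: eqangleD => //; elim/big_ind2: _ => // [*|k _]; first exact: eqangleD.
exact/eqangle_principal/step_gt0.
Qed.

(** A continuous map from a compact set to a Hausdorff space is closed, hence a quotient map onto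
    its image, so continuity descends along [q]. *)
Lemma continuous_compact_image (X Y : topologicalType) (K : set X)
    (q : X -> Y) (L : Y -> R) : hausdorff_space Y -> compact K ->
  {within K, continuous q} -> {within K, continuous (L \o q)} ->
  {within q @` K, continuous L}.
Proof.
move=> hY cK cq cLq; apply/continuous_closedP => W cW.
move/continuous_closedP : cLq => /(_ _ cW)/closed_subspaceP[V cV VW].
apply/closed_subspaceP; exists (q @` (K `&` V)).
  apply: compact_closed => //; apply: continuous_compact; last exact: compact_closedI.
  by apply: continuous_subspaceW cq => ? [].
apply/seteqP; split => [y [[x [Kx Vx] <-] _]|y [/= Wx [x Kx ex]]].
  have : (V `&` K) x by [].
  by rewrite VW => -[/= ? _]; split => //; exists x.
subst y; have [Vx _] : (V `&` K) x by rewrite VW; split; [exact: Wx|].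
by split; exists x.
Qed.

Lemma hausdorff_plane : hausdorff_space (R * R)%type.
Proof. exact: norm_hausdorff. Qed.

Lemma arc_compact (p q : R * R) (A : set (R * R)) : is_arc p q A -> compact A.
Proof.
move=> [g [cg _ _ _ <-]]; apply: continuous_compact => //.
exact: segment_compact.
Qed.

Lemma arc_connected (p q : R * R) (A : set (R * R)) : is_arc p q A -> connected A.
Proof.
move=> [g [cg _ _ _ <-]]; apply: connected_continuous_connected => //.
exact: segment_connected.
Qed.

Lemma arc_lift (p q : R * R) (A : set (R * R)) (phi : R * R -> R) :
  is_arc p q A -> angular_continuous A phi -> exists L, is_lift A phi L.
Proof.
move=> [g [cg ig _ _ gA]] cphi.
(* [starshaped_lift] wants a map on the whole line, so the parametrization is precomposed with the
   retraction onto [0, 1]. *)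
pose clamp (t : R) := Num.max 0 (Num.min 1 t).
have clamp01 t : `[0, 1]%classic (clamp t).
  by rewrite /= in_itv/= /clamp le_max lexx/= ge_max ler01/= ge_min lexx.
have clampK t : `[0, 1]%classic t -> clamp t = t.
  by rewrite /= in_itv/= /clamp => /andP[t0 t1]; rewrite min_r// max_r.
have cclamp : continuous clamp.
  move=> t; apply: continuous_max; first exact: cvg_cst.
  by apply: continuous_min; [exact: cvg_cst|exact: cvg_id].
have cphig : angular_continuous setT (phi \o g \o clamp).
  apply: (@angular_continuous_comp R R setT `[0, 1]%classic clamp (phi \o g)) => //.
    exact: continuous_subspaceT.
  by apply: (angular_continuous_comp _ _ cphi) => // t t01; rewrite -gA; exists t.
have [|H [cH eH]] := starshaped_lift (@segment_compact R 0 1) _ cphig.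
  move=> z s /=; rewrite !in_itv/= => /andP[z0 z1] /andP[s0 s1].
  by rewrite mulr_ge0//= mulr_ile1.
(* The lift is carried over to the arc through the parameter of [z], which is unique because [g] is
   injective. *)
pose L z := H (xget 0 [set t | `[0, 1]%classic t /\ g t = z]).
have LH t : `[0, 1]%classic t -> L (g t) = H t.
  move=> t01; rewrite /L; case: xgetP => [y _ [y01 ey]|/(_ t)]; last by case.
  by congr H; apply: ig; rewrite ?inE.
exists L; split; rewrite -gA; last first.
  by move=> _ [t t01 <-]; rewrite LH//; have := eH t t01; rewrite /= clampK.
apply: continuous_compact_image => //.
- exact: segment_compact.
- by apply: subspace_eq_continuous cH => t; rewrite inE => t01;
    rewrite -[RHS]/(L (g t)) LH.
Qed.

End AngularContinuity.

(** * Open sets in the plane *)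

Section Plane.
Variable R : realType.

Lemma within_continuous_bigcup_seq (X Y : topologicalType) (I : eqType)
    (l : seq I) (F : I -> set X) (h : X -> Y) :
  (forall i, i \in l -> closed (F i)) ->
  (forall i, i \in l -> {within F i, continuous h}) ->
  {within \bigcup_(i in [set i | i \in l]) F i, continuous h}.
Proof.
move=> cF ch.
(* Pasting two pieces needs both to be closed, so closedness is carried through the induction. *)
suff [] : closed (\bigcup_(i in [set i | i \in l]) F i) /\
  {within \bigcup_(i in [set i | i \in l]) F i, continuous h} by [].
elim: l cF ch => [|i l IH] cF ch.
  rewrite (_ : [set _ | _] = set0) ?bigcup_set0; last first.
    by apply/seteqP; split => // i.
  by split; [exact: closed0|exact: continuous_subspace0].
have [|j jl|cl hl] := IH; first by move=> j jl; apply: cF; rewrite inE jl orbT.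
  by apply: ch; rewrite inE jl orbT.
rewrite (_ : \bigcup_(_ in _) _ = F i `|` \bigcup_(i in [set i | i \in l]) F i).
  have cFi : closed (F i) by apply: cF; rewrite inE eqxx.
  have hi : {within F i, continuous h} by apply: ch; rewrite inE eqxx.
  by split; [exact: closedU|exact: withinU_continuous].
apply/seteqP; split => x.
  by move=> [j /=]; rewrite inE => /predU1P[->|jl] Fx; [left|right; exists j].
move=> [Fx|[j /= jl Fx]]; first by exists i => //=; rewrite inE eqxx.
by exists j => //=; rewrite inE jl orbT.
Qed.

Lemma ball_connected (V : normedModType R) (p : V) (r : R) : 0 < r -> connected (ball p r).
Proof.
move=> r0.
pose seg (z : V) := (fun s : R => p + s *: (z - p)) @` `[0, 1]%classic.
have -> : ball p r = \bigcup_(z in ball p r) seg z.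
  apply/seteqP; split => [z pz|_ [z pz [s /= s01 <-]]].
    by exists z => //; exists 1; rewrite /= ?in_itv/= ?ler01 ?lexx// scale1r addrC subrK.
  move: pz; rewrite -ball_normE /= => pz.
  rewrite opprD addNKr normrN normrZ distrC (le_lt_trans _ pz)//.
  move: s01; rewrite in_itv/= => /andP[s0 s1].
  by rewrite ger0_norm// distrC ler_piMl.
apply: bigcup_connected.
  exists p => z _; exists 0; first by rewrite /= in_itv/= lexx ler01.
  by rewrite scale0r addr0.
move=> z _; apply: connected_continuous_connected; first exact: segment_connected.
apply: continuous_subspaceT => s; apply: cvgD; first exact: cvg_cst.
by apply: cvgZr_tmp; exact: cvg_id.
Qed.

Lemma connected_component_open (V : normedModType R) (U : set V) (x : V) :
  open U -> open (connected_component U x).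
Proof.
move=> oU; rewrite openE => y Uxy.
have Uy := connected_component_sub Uxy.
have /nbhs_ballP[r /= r0 rU] : nbhs y U by apply: open_nbhs_nbhs.
apply/nbhs_ballP; exists r => //= z yz.
apply: (connected_component_trans Uxy).
apply: (connected_component_max (B := ball y r)) => //.
  exact: ballxx.
exact: ball_connected.
Qed.

Lemma locally_constant_cst (X : topologicalType) (Y : Type) (f : set X) (w : X -> Y) :
  open f -> connected f ->
  (forall x, f x -> \forall y \near x, w y = w x) ->
  forall x y, f x -> f y -> w x = w y.
Proof.
move=> of_ cf lc x y fx fy.
have O (P : Y -> Prop) : open [set z | f z /\ P (w z)].
  rewrite openE => z [fz Pz].
  have nf : nbhs z f by apply: open_nbhs_nbhs.
  have H := lc z fz; apply: filterS2 nf H => u fu e.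
  by split => //; rewrite e.
have : [set z | f z /\ w z = w x] = f.
  apply: cf; first by exists x.
    exists [set z | f z /\ w z = w x]; first exact: (O (fun u => u = w x)).
    by apply/seteqP; split => z; [case|case].
  exists (~` [set z | f z /\ w z <> w x]).
    by apply: open_closedC; exact: (O (fun u => u <> w x)).
  apply/seteqP; split => z; first by move=> [fz e]; split => // -[].
  by move=> [fz h]; split => //; apply: contrapT => e; apply: h.
by move/seteqP => [_ /(_ y fy)[_ ->]].
Qed.

(* If the angle had a lift on the boundary, Tietze's theorem would extend the
   lift over [f]; pasting it with the angle outside [f] gives a map that lifts
   on the whole plane, although it winds [n] times around a large circle. *)
Lemma frontier_lift_index (f : set (R * R)) (x y : R * R) (n m : int)
    (L : R * R -> R) :
  open f -> bounded_set f -> compact (closure f `\` f) -> f x -> ~ closure f y ->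
  is_lift (closure f `\` f) (fun z => angle_from x z *~ n - angle_from y z *~ m) L ->
  n = 0.
Proof.
move=> of_ [B0 [B0r hB0]] cK fx fy [cL eL].
have [M [M0 hM]] : exists M : R, 0 < M /\
    (forall z, (closure f `\` f) z -> `|L z| <= M).
  have /compact_bounded[M [Mr hM]] := continuous_compact cL cK.
  exists (`|M| + 1); split; first by rewrite ltr_wpDl.
  move=> z Kz; apply: (hM (`|M| + 1)); last by exists z.
  by rewrite (le_lt_trans (ler_norm _))// ltrDl.
have clK : closed (closure f `\` f) by apply: compact_closed => //; exact: hausdorff_plane.
have [L' [LL' cL' _]] := continuous_bounded_extension
  (@pseudometric_normal R (R * R)%type) clK M0 cL hM.
(* The two formulas agree modulo 2 pi on the frontier. Each is continuous modulo 2 pi on its closed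
   piece, since [y] is outside the closure and [x] is inside [f]. *)
pose Phi z := if `[< closure f z >] then L' z + angle_from y z *~ m
  else angle_from x z *~ n.
have cPhi : angular_continuous setT Phi.
  have -> : [set: R * R] = closure f `|` ~` f.
    apply/seteqP; split => // z _; have [fz|fz] := pselect (f z); last by right.
    by left; exact: subset_closure.
  apply: angular_continuousU; [exact: closed_closure|exact: open_closedC| |].
    apply: (@eq_angular_continuous _ _ _ (fun z => L' z + angle_from y z *~ m)).
      by move=> z fz; rewrite /Phi asboolT.
    apply: angular_continuousD; last first.
      exact/angular_continuousMz/angular_continuous_angle_from.
    exact/continuous_angular_continuous/continuous_subspaceT.
  apply: (@eq_angular_continuous _ _ _ (fun z => angle_from x z *~ n)).
    move=> z fz; rewrite /Phi; case: asboolP => // cfz.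
    have Kz : (closure f `\` f) z by [].
    rewrite -LL' ?inE//; apply/eqangle_sym.
    rewrite -[X in eqangle _ X](subrK (angle_from y z *~ m)).
    by apply: eqangleD => //; exact: eL.
  apply/angular_continuousMz/angular_continuous_angle_from.
  by apply; exact: fx.
pose B := `|B0| + 1.
have B_gt0 : 0 < B by rewrite ltr_wpDl.
have hB z : closure f z -> `|z| <= B.
  have cl : closed [set z : R * R | `|z| <= B].
    have : closed ((fun z : R * R => `|z|) @^-1` [set t | t <= B]).
      apply: closed_comp => [u _|]; first exact: norm_continuous.
      exact: closed_le.
    by [].
  have : f `<=` [set z : R * R | `|z| <= B].
    by apply: hB0; rewrite (le_lt_trans (ler_norm _))// ltrDl.
  by move=> /closureS; rewrite -(iffLR (closure_id _) cl); apply.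
(* A point of the circle in the closure of [f] would give rho^2 <= 2 (B + |x|)^2, which the factor 2
   rules out. *)
pose rho := 2 * (B + `|x| + 1).
have rho0 : 0 < rho by rewrite mulr_gt0// addr_gt0// ltr_wpDr.
pose circ t : R * R := (x.1 + rho * cos t, x.2 + rho * sin t).
have nx1 : `|x.1| <= `|x| by rewrite prod_normE le_max lexx.
have nx2 : `|x.2| <= `|x| by rewrite prod_normE le_max lexx orbT.
have circ_out t : ~ closure f (circ t).
  move=> /hB; rewrite prod_normE ge_max /= => /andP[h1 h2].
  have k1 : `|rho * cos t| <= B + `|x|.
    rewrite (_ : rho * cos t = (x.1 + rho * cos t) - x.1); last by ring.
    by rewrite (le_trans (ler_normB _ _))// lerD.
  have k2 : `|rho * sin t| <= B + `|x|.
    rewrite (_ : rho * sin t = (x.2 + rho * sin t) - x.2); last by ring.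
    by rewrite (le_trans (ler_normB _ _))// lerD.
  have e : (rho * cos t) ^+ 2 + (rho * sin t) ^+ 2 = rho ^+ 2.
    by rewrite !exprMn -mulrDr cos2Dsin2 mulr1.
  have sq (a b : R) : `|a| <= b -> a ^+ 2 <= b ^+ 2.
    move=> ab; rewrite -(real_normK (num_real a)) ler_pXn2r// ?nnegrE//.
    exact: le_trans ab.
  have aux (a b : R) : 0 < b -> 0 <= a ->
      ~ (2 * (b + a + 1)) ^+ 2 <= (b + a) ^+ 2 + (b + a) ^+ 2.
    by move=> b0 a0; rewrite !expr2; nra.
  by have := lerD (sq _ _ k1) (sq _ _ k2); rewrite e; exact: aux.
(* The square of half-side [C] is starshaped about the origin and contains the circle. *)
pose C := `|x| + rho.
have [||H [cH eH]] := @starshaped_lift R (R * R)%type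
  (`[- C, C]%classic `*` `[- C, C]%classic) Phi _ _ cPhi.
- by apply: compact_setX; exact: segment_compact.
- move=> z s [/=]; rewrite !in_itv/= -!ler_norml => z1 z2 /andP[s0 s1].
  rewrite !normrM (ger0_norm s0).
  by split; [apply: le_trans z1|apply: le_trans z2]; rewrite ler_piMl.
have circ_in t : (`[- C, C]%classic `*` `[- C, C]%classic) (circ t).
  have bnd (a e : R) : `|a| <= `|x| -> `|e| <= 1 -> - C <= a + rho * e <= C.
    move=> ax e1; rewrite -ler_norml (le_trans (ler_normD _ _))// lerD//.
    by rewrite normrM gtr0_norm// ler_piMr// ltW.
  by split; rewrite /= in_itv/=; apply: bnd => //; rewrite ?cos_max ?sin_max.
(* On the circle [H] lifts [t *~ n], so [psi] is constant; as the circle closes up after 2 pi, this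
   gives 2 pi n = 0. *)
pose psi t := H (circ t) - t *~ n.
have : psi 0 = psi (pi *+ 2).
  have pi2 : 0 <= (pi : R) *+ 2 by rewrite mulrn_wge0// pi_ge0.
  have c1 : {within `[0, pi *+ 2]%classic, continuous (H \o circ)}.
    apply: (within_continuous_comp (f := circ) (g := H)
      (B := `[- C, C]%classic `*` `[- C, C]%classic)) => //.
    apply: continuous_subspaceT => t.
    have circ1 : (fun s => (circ s).1) @ t --> (circ t).1.
      apply: cvgD; first exact: cvg_cst.
      by apply: cvgM; [exact: cvg_cst|exact: continuous_cos].
    have circ2 : (fun s => (circ s).2) @ t --> (circ t).2.
      apply: cvgD; first exact: cvg_cst.
      by apply: cvgM; [exact: cvg_cst|exact: continuous_sin].
    exact: (cvg_pair circ1 circ2).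
  have c2 : {within `[0, pi *+ 2]%classic, continuous (fun t : R => t *~ n)}.
    have -> : (fun t : R => t *~ n) = (fun t => t * n%:~R).
      by apply: funext => t; rewrite mulrzr.
    apply: continuous_subspaceT => t.
    by apply: cvgM; [exact: cvg_id|exact: cvg_cst].
  apply: (@continuous_eqangle0_cst R R `[0, pi *+ 2]%classic psi).
  - exact: segment_connected.
  - by move=> t; apply: cvgB; [exact: c1|exact: c2].
  - move=> t _; rewrite /psi -[X in eqangle _ X](subrr (t *~ n)).
    apply: eqangleB => //; apply: (eqangle_trans (eH _ (circ_in t))).
    rewrite /Phi asboolF//; apply: eqangleMz; exact: angle_from_circle.
  - by rewrite /= in_itv/= lexx.
  - by rewrite /= in_itv/= lexx andbT.
rewrite /psi (_ : circ (pi *+ 2) = circ 0); last first.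
  by rewrite /circ cos2pi sin2pi cos0 sin0.
rewrite mul0rz subr0 => /esym/eqP; rewrite subr_eq addrC -subr_eq subrr eq_sym.
by rewrite mulrz_eq0 => /orP[/eqP//|]; rewrite mulrn_eq0/= gt_eqF// pi_gt0.
Qed.

End Plane.

(** * Cyclic sequences *)

Section CyclicSequences.
Variable T : eqType.
Implicit Types (c : seq T) (s : T).

(** At the last index the right-hand side is out of range, and its default [s0] is the cyclic
    successor. *)
Lemma next_nth_cons s0 c i : uniq (s0 :: c) -> (i < size (s0 :: c))%N ->
  next (s0 :: c) (nth s0 (s0 :: c) i) = nth s0 c i.
Proof. by move=> uc ic; rewrite next_nth mem_nth// index_uniq. Qed.

Lemma next_next_neq c s : uniq c -> (2 < size c)%N -> s \in c ->
  next c (next c s) != s.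
Proof.
move=> uc c2 sc; have [i c' ec] := rot_to sc.
rewrite -!(next_rot i uc) ec.
have : uniq (s :: c') by rewrite -ec rot_uniq.
have : (2 < size (s :: c'))%N by rewrite -ec size_rot.
case: c' {ec} => [|a [|b c']]//= _ /andP[sN /andP[aN _]].
rewrite eqxx; move: sN; rewrite !inE !negb_or => /and3P[sa sb _].
by rewrite [a == s]eq_sym (negPf sa) eqxx eq_sym.
Qed.

Lemma sum_next (R : zmodType) c (F : T -> R) : uniq c ->
  \sum_(s <- c) F (next c s) = \sum_(s <- c) F s.
Proof.
move=> uc; rewrite -(big_map (next c) xpredT F); apply: perm_big.
have um : uniq (map (next c) c) by rewrite map_inj_uniq//; exact: can_inj (prev_next uc).
apply: uniq_perm => // s; apply/mapP/idP => [[t tc ->]|sc].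
  by rewrite mem_next.
by exists (prev c s); rewrite ?mem_prev// next_prev.
Qed.

(** The potential is the partial sum of the increments, starting from the angle at the first
    vertex. *)
Lemma cyclic_potential (R : realType) c (d phi : T -> R) : uniq c ->
  \sum_(s <- c) d s = 0 ->
  (forall s, s \in c -> eqangle (d s) (phi (next c s) - phi s)) ->
  exists P : T -> R, forall s, s \in c ->
    P (next c s) = P s + d s /\ eqangle (P s) (phi s).
Proof.
case: c => [|s0 c] uc d0 ed; first by exists phi.
set C := s0 :: c in uc d0 ed *.
pose P s := phi s0 + \sum_(0 <= j < index s C) d (nth s0 C j).
have Pnth i : (i < size C)%N ->
    P (nth s0 C i) = phi s0 + \sum_(0 <= j < i) d (nth s0 C j).
  by move=> iC; rewrite /P index_uniq.
have Pstep i : (i < size C)%N ->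
    P (next C (nth s0 C i)) = P (nth s0 C i) + d (nth s0 C i).
  move=> iC; rewrite next_nth_cons// Pnth// -addrA -big_nat_recr//=.
  (* After the last index the successor is [s0] again, and the vanishing total closes the loop. *)
  move: iC; rewrite /= ltnS leq_eqVlt => /predU1P[->|ic].
    rewrite nth_default// /P /= eqxx big_nil addr0.
    move: d0; rewrite (big_nth s0) => d0.
    by rewrite [X in _ + X]d0 addr0.
  by rewrite -[nth s0 c i]/(nth s0 C i.+1) Pnth.
exists P => s sC; have iC : (index s C < size C)%N by rewrite index_mem.
rewrite -(nth_index s0 sC); split; first exact: Pstep.
elim: (index s C) iC => [|i IH] iC; first by rewrite Pnth// big_nil addr0.
have iC' : (i < size C)%N by exact: ltnW.
have e : next C (nth s0 C i) = nth s0 C i.+1 by rewrite next_nth_cons.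
rewrite -e Pstep// -[X in eqangle _ X](subrKC (phi (nth s0 C i))) addrC addrC.
by apply: eqangleD; [exact: IH|apply: ed; rewrite mem_nth].
Qed.

End CyclicSequences.

(** * Winding numbers in plane graphs *)

Section PlaneGraphWinding.
Variables (R : realType) (T : finType) (G : plane_graph R T).
Implicit Types (u v s t : T) (c : seq T) (x y p z : R * R) (A : {set T}).

Local Notation plane := (R * R)%type.
Local Notation edge s t := (finset.setU (finset.set1 s) (finset.set1 t)).

Lemma edge_in_edge_set u v : erel G u v -> edge u v \in edge_set G.
Proof. by move=> uv; apply/imsetP; exists (u, v); rewrite ?inE. Qed.

Lemma edge_setP A : A \in edge_set G -> exists u v, erel G u v /\ A = edge u v.
Proof. by move=> /imsetP[[u v]]; rewrite inE /= => uv ->; exists u, v. Qed.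

Lemma edge_is_arc u v : erel G u v ->
  is_arc (pos G u) (pos G v) (curve G (edge u v)).
Proof. exact: curve_arc. Qed.

Lemma curve_compact A : A \in edge_set G -> compact (curve G A).
Proof. by move=> /edge_setP[u [v [uv ->]]]; exact: arc_compact (edge_is_arc uv). Qed.

Lemma curve_closed A : A \in edge_set G -> closed (curve G A).
Proof.
by move=> /curve_compact; apply: compact_closed; exact: hausdorff_plane.
Qed.

Lemma curve_end u v w : erel G u v -> w \in edge u v ->
  curve G (edge u v) (pos G w).
Proof.
move=> uv; have [g [_ _ g0 g1 gA]] := edge_is_arc uv.
rewrite -gA !inE => /orP[/eqP->|/eqP->].
  by exists 0; rewrite //= in_itv/= lexx ler01.
by exists 1; rewrite //= in_itv/= lexx ler01.
Qed.

(** The point of parameter 1/2 is not an end by injectivity, and distinct edges meet only at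
    vertices. *)
Lemma curve_midpoint A : A \in edge_set G -> exists p,
  [/\ curve G A p, forall s, p <> pos G s &
      forall B, B \in edge_set G -> B != A -> ~ curve G B p].
Proof.
move=> Ae; have [u [v [uv eA]]] := edge_setP Ae.
have [g [_ gi g0 g1 gA]] := edge_is_arc uv; rewrite -eA in gA.
have hp : curve G A (g (1 / 2)).
  by rewrite -gA; exists (1 / 2) => //=; rewrite in_itv/=; lra.
have np s : g (1 / 2) <> pos G s.
  move=> e; have : s \in A by apply: (curve_vertex Ae); rewrite -e.
  rewrite eA !inE => /orP[/eqP es|/eqP es].
    have : 1 / 2 = 0 :> R by apply: gi; rewrite ?in_itv/= ?e ?es ?g0//; lra.
    lra.
  have : 1 / 2 = 1 :> R by apply: gi; rewrite ?in_itv/= ?e ?es ?g1//; lra.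
  lra.
exists (g (1 / 2)); split => // B Be BA Bp.
have [s _ es] := curve_meet Be Ae BA (conj Bp hp).
by case: (np s).
Qed.

(* The lift is chosen for the undirected edge, which makes [edge_turn]
   antisymmetric. *)
Definition edge_lift (x : plane) (A : {set T}) : plane -> R :=
  xget (fun=> 0) [set L | is_lift (curve G A) (angle_from x) L].

Lemma edge_liftP x A : A \in edge_set G -> ~ curve G A x ->
  is_lift (curve G A) (angle_from x) (edge_lift x A).
Proof.
move=> Ae Ax; have [u [v [uv eA]]] := edge_setP Ae.
have arcA := edge_is_arc uv; rewrite -eA in arcA.
have [L hL] := arc_lift arcA (angular_continuous_angle_from Ax).
exact: (xgetPex (fun=> 0) (ex_intro _ L hL)).
Qed.

Definition edge_turn x s t : R :=
  edge_lift x (edge s t) (pos G t) - edge_lift x (edge s t) (pos G s).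

Lemma edge_turnC x s t : edge_turn x t s = - edge_turn x s t.
Proof. by rewrite /edge_turn finset.setUC opprB. Qed.

(** Off the curve this is 2 pi times the usual winding number. Nothing is known about the turn of an
    edge through [x]. *)
Definition winding c x : R := \sum_(s <- c) edge_turn x s (next c s).

Lemma cycle_uniq c : is_cycle G c -> uniq c.
Proof. by case/andP => /andP[]. Qed.

Lemma cycle_erel c s : is_cycle G c -> s \in c -> erel G s (next c s).
Proof. by case/andP => /andP[cc _] _; exact: next_cycle. Qed.

Lemma cycle_edgesP c A : reflect (exists2 s, s \in c & A = edge s (next c s))
  (A \in cycle_edges c).
Proof. exact: mapP. Qed.

Lemma mem_cycle_edges c s : s \in c -> edge s (next c s) \in cycle_edges c.
Proof. by move=> sc; apply/cycle_edgesP; exists s. Qed.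

Lemma curvesE c : curves G [set:: cycle_edges c]%SET =
  \bigcup_(A in [set A | A \in cycle_edges c]) curve G A.
Proof. by congr bigcup; apply/funext => A /=; rewrite inE. Qed.

Lemma cycle_edges_edge c A : is_cycle G c -> A \in cycle_edges c ->
  A \in edge_set G.
Proof.
by move=> cc /cycle_edgesP[s sc ->]; exact/edge_in_edge_set/cycle_erel.
Qed.

(** Otherwise the cycle would go from [s] to [t] and straight back, which its length forbids. *)
Lemma cycle_edge_inj c s t : is_cycle G c -> s \in c -> t \in c ->
  edge s (next c s) = edge t (next c t) -> s = t.
Proof.
move=> cc sc tc e; apply: contrapT => st.
have s2 : s = next c t.
  have : s \in edge t (next c t) by rewrite -e !inE eqxx.
  by rewrite !inE => /orP[/eqP//|/eqP].
have t2 : t = next c s.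
  have : t \in edge s (next c s) by rewrite e !inE eqxx.
  by rewrite !inE => /orP[/eqP/esym//|/eqP].
have /andP[_ c2] := cc.
have := next_next_neq (cycle_uniq cc) c2 sc.
by rewrite -t2 -s2 eqxx.
Qed.

(* Shifting the lifts of the edges to agree at the vertices is possible exactly
   when the total turn around the cycle vanishes. *)
Lemma cycle_lift c (phi : plane -> R) (L : {set T} -> plane -> R) :
  is_cycle G c ->
  (forall A, A \in cycle_edges c -> is_lift (curve G A) phi (L A)) ->
  \sum_(s <- c) (L (edge s (next c s)) (pos G (next c s)) -
                 L (edge s (next c s)) (pos G s)) = 0 ->
  exists H, is_lift (curves G [set:: cycle_edges c]%SET) phi H.
Proof.
move=> cc hL d0; have uc := cycle_uniq cc.
have cs s : s \in c -> curve G (edge s (next c s)) (pos G s).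
  by move=> sc; apply: curve_end; [exact: cycle_erel|rewrite !inE eqxx].
have cn s : s \in c -> curve G (edge s (next c s)) (pos G (next c s)).
  by move=> sc; apply: curve_end; [exact: cycle_erel|rewrite !inE eqxx orbT].
have [|P hP] := cyclic_potential (phi := phi \o pos G) uc d0.
  move=> s sc; have [_ e] := hL _ (mem_cycle_edges sc).
  by apply: eqangleB; [exact/e/cn|exact/e/cs].
(* The lift on the edge leaving [s] is shifted to take the value [P s] at [s]; it then takes the
   value of [P] at the other end too. *)
pose M s z := L (edge s (next c s)) z + (P s - L (edge s (next c s)) (pos G s)).
have Mend s w : s \in c -> w \in edge s (next c s) -> M s (pos G w) = P w.
  move=> sc; rewrite !inE => /orP[/eqP->|/eqP->]; rewrite /M; first by ring.
  by have [-> _] := hP s sc; ring.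
(* Two edges of the cycle meet only at common vertices, where both shifted lifts equal [P]. *)
have Meq s t z : s \in c -> t \in c -> curve G (edge s (next c s)) z ->
    curve G (edge t (next c t)) z -> M s z = M t z.
  move=> sc tc zs zt; have [->//|st] := eqVneq s t.
  have ne : edge s (next c s) != edge t (next c t).
    by apply: contra st => /eqP/(cycle_edge_inj cc sc tc)->.
  have se := cycle_edges_edge cc (mem_cycle_edges sc).
  have te := cycle_edges_edge cc (mem_cycle_edges tc).
  have [w + <-] := curve_meet se te ne (conj zs zt).
  by rewrite /= finset.inE => /andP[ws wt]; rewrite !Mend.
pose H z := if [pick s | (s \in c) && `[< curve G (edge s (next c s)) z >]] is Some s
  then M s z else 0.
have HM s z : s \in c -> curve G (edge s (next c s)) z -> H z = M s z.
  move=> sc zs; rewrite /H; case: pickP => [t /andP[tc /asboolP zt]|/(_ s)].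
    exact: Meq.
  by rewrite sc asboolT.
exists H; split.
  rewrite curvesE; apply: within_continuous_bigcup_seq => A Ac.
    exact/curve_closed/(cycle_edges_edge cc).
  have /cycle_edgesP[s sc eA] := Ac.
  have [cL _] := hL _ Ac.
  apply: (@subspace_eq_continuous _ _ _ (M s)).
    by move=> z; rewrite inE eA => zs; exact/esym/HM.
  by move=> z; rewrite /M -eA; apply: cvgD; [exact: cL|exact: cvg_cst].
move=> z; rewrite curvesE => -[A /= /cycle_edgesP[s sc ->] zs].
rewrite (HM s)// /M.
have [_ e] := hL _ (mem_cycle_edges sc).
rewrite -[X in eqangle _ X]addr0; apply: eqangleD; first exact: e.
have [_ eP] := hP s sc.
rewrite -(subrr (phi (pos G s))); apply: eqangleB => //.
exact/e/cs.
Qed.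

(** Modulo 2 pi each turn is a difference of angles at the ends, and these telescope around the
    cycle. *)
Lemma winding_eqangle0 c x : is_cycle G c ->
  ~ curves G [set:: cycle_edges c]%SET x -> eqangle (winding c x) 0.
Proof.
move=> cc cx.
have -> : 0 = \sum_(s <- c) (angle_from x (pos G (next c s)) - angle_from x (pos G s)).
  by rewrite sumrB (sum_next (fun s => angle_from x (pos G s)) (cycle_uniq cc)) subrr.
rewrite /winding !big_seq; elim/big_ind2: _ => // [*|s sc]; first exact: eqangleD.
have [|_ e] := @edge_liftP x _ (cycle_edges_edge cc (mem_cycle_edges sc)).
  by move=> xs; apply: cx; rewrite curvesE; exists (edge s (next c s)) => //=;
    exact: mem_cycle_edges.
apply: eqangleB; apply: e; apply: curve_end; rewrite ?(cycle_erel cc sc)//.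
  by rewrite !inE eqxx orbT.
by rewrite !inE eqxx.
Qed.

Lemma drawing_closed : closed (drawing G).
Proof.
apply: closedU.
  rewrite -bigcup_imset1; apply: closed_bigcup; first exact: finite_finset.
  by move=> s _; apply: compact_closed; [exact: hausdorff_plane|exact: compact_set1].
rewrite /curves; apply: closed_bigcup; first exact: finite_finset.
by move=> A /= Ae; exact: curve_closed.
Qed.

Lemma face_open f : face G f -> open f.
Proof.
move=> [x xd ->]; apply: connected_component_open.
exact/closed_openC/drawing_closed.
Qed.

Lemma face_connected f : face G f -> connected f.
Proof. by move=> [x xd ->]; exact: component_connected. Qed.

Lemma face_nonempty f : face G f -> f !=set0.
Proof. by move=> [x xd ->]; exists x; exact: connected_component_refl. Qed.

Lemma face_avoids_drawing f x : face G f -> f x -> ~ drawing G x.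
Proof. by move=> [y yd ->] /connected_component_sub. Qed.

Lemma face_avoids_curve f x A : face G f -> f x -> A \in edge_set G ->
  ~ curve G A x.
Proof.
by move=> ff fx Ae Ax; apply: (face_avoids_drawing ff fx); right; exists A.
Qed.

(** The open set [g] would meet [f], and components that meet coincide. *)
Lemma faces_closure_disjoint f g y : face G f -> face G g -> f <> g -> g y ->
  ~ closure f y.
Proof.
move=> ff gg fg gy clfy.
have [z [fz gz]] : f `&` g !=set0.
  by apply: clfy; apply: open_nbhs_nbhs; split => //; exact: face_open.
apply: fg; move: ff gg fz gz => [a _ ->] [b _ ->] az bz.
by rewrite (same_connected_component az) (same_connected_component bz).
Qed.

Lemma frontier_open (f : set plane) : open f -> frontier f = closure f `\` f.
Proof. by move=> of_; rewrite /frontier (iffLR (interior_id _) of_). Qed.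

Lemma curves_compact c : is_cycle G c ->
  compact (curves G [set:: cycle_edges c]%SET).
Proof.
move=> cc; rewrite curvesE.
have : forall A, A \in cycle_edges c -> compact (curve G A).
  by move=> A Ac; exact/curve_compact/(cycle_edges_edge cc).
elim: (cycle_edges c) => [|A l IH] hl.
  rewrite (_ : [set _ | _] = set0) ?bigcup_set0; first exact: compact0.
  by apply/seteqP; split.
rewrite (_ : \bigcup_(_ in _) _ =
    curve G A `|` \bigcup_(B in [set B | B \in l]) curve G B).
  apply: compactU; first by apply: hl; rewrite inE eqxx.
  by apply: IH => B Bl; apply: hl; rewrite inE Bl orbT.
apply/seteqP; split => x.
  by move=> [j /=]; rewrite inE => /predU1P[->|jl] Fx; [left|right; exists j].
move=> [Fx|[j /= jl Fx]]; first by exists A => //=; rewrite inE eqxx.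
by exists j => //=; rewrite inE jl orbT.
Qed.

Section RegionWinding.
Variables (c : seq T) (f : set plane) (x y : plane).
Hypotheses (cf : bounds G c f) (fx : f x) (fy : ~ closure f y).

(** The equality makes the total turn of the combined angle vanish, so [cycle_lift] provides the
    lift excluded by [frontier_lift_index] for nonzero [n]. *)
Let combination (n m : int) :
  winding c x *~ n = winding c y *~ m -> n = 0.
Proof.
move=> e; have [cc [ff bf] fr] := cf.
have of_ := face_open ff.
have cx A : A \in cycle_edges c -> ~ curve G A x.
  by move=> Ac; apply: (face_avoids_curve ff fx); exact: cycle_edges_edge Ac.
have cy A : A \in cycle_edges c -> ~ curve G A y.
  move=> Ac Ay; have [] : frontier f y; last by [].
  by rewrite fr curvesE; exists A.
rewrite (frontier_open of_) in fr.
pose L A z := edge_lift x A z *~ n - edge_lift y A z *~ m.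
have [||H hH] := @cycle_lift c (fun z => angle_from x z *~ n - angle_from y z *~ m) L cc.
- move=> A Ac; have Ae := cycle_edges_edge cc Ac.
  have [cLx eLx] := edge_liftP Ae (cx A Ac).
  have [cLy eLy] := edge_liftP Ae (cy A Ac).
  have Z (k : int) (h : plane -> R) : {within curve G A, continuous h} ->
      {within curve G A, continuous (fun z => h z *~ k)}.
    move=> ch.
    have -> : (fun z => h z *~ k) = (fun z => h z * k%:~R).
      by apply: funext => z; rewrite mulrzr.
    by move=> z; apply: cvgM; [exact: ch|exact: cvg_cst].
  split; first by move=> z; apply: cvgB; [exact: (Z n _ cLx)|exact: (Z m _ cLy)].
  by move=> z Az; apply: eqangleB; apply: eqangleMz; [exact: eLx|exact: eLy].
- rewrite /L (eq_bigr (fun s => edge_turn x s (next c s) *~ n -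
    edge_turn y s (next c s) *~ m)); last first.
    by move=> s _; rewrite /edge_turn !mulrzBl; ring.
  by rewrite sumrB -!mulrz_suml -/(winding c x) -/(winding c y) e subrr.
apply: (frontier_lift_index of_ bf _ fx fy (n := n) (m := m) (L := H)).
  by rewrite fr; exact: curves_compact.
by rewrite fr.
Qed.

Lemma winding_outside : winding c y = 0.
Proof.
have [cc [ff bf] fr] := cf.
have of_ := face_open ff.
have [k ek] : exists k : int, winding c x = 0 + pi *+ 2 *~ k.
  apply/eqangle_int/winding_eqangle0 => //; rewrite -fr frontier_open//.
  by case.
have [l el] : exists k : int, winding c y = 0 + pi *+ 2 *~ k.
  by apply/eqangle_int/winding_eqangle0 => //; rewrite -fr => -[].
(* With windings 2 pi k at [x] and 2 pi l at [y], the multipliers [l] and [k] balance, so [l]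
   vanishes. *)
have l0 : l = 0.
  by apply: (combination (m := k)); rewrite ek el !add0r -!mulrzA mulrC.
by rewrite el l0 mulr0z addr0.
Qed.

Lemma winding_inside : winding c x <> 0.
Proof.
move=> w0; have : (1 : int) = 0; last by [].
by apply: (combination (m := 0)); rewrite w0 mul0rz mulr0z.
Qed.

End RegionWinding.

(** The signed angle at [z] between the directions of [p] and [x], meaningful while it is acute. *)
Definition shift_angle x p z : R := principal (angle_from x z - angle_from p z).

(** Along the edge, the difference of the two lifts and [shift_angle] represent the same angle
    modulo 2 pi, so on the connected arc they differ by a constant. *)
Lemma edge_turn_shift s t x p (r : R) : erel G s t ->
  (forall z, curve G (edge s t) z -> ~ ball p r z) -> ball p (r / 2) x ->
  edge_turn x s t - edge_turn p s t =
  shift_angle x p (pos G t) - shift_angle x p (pos G s).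
Proof.
move=> st hr px.
have r0 : 0 < r.
  by move: px => [+ _]; rewrite /ball/= => /(le_lt_trans (normr_ge0 _)); lra.
have ste := edge_in_edge_set st.
have cx : ~ curve G (edge s t) x.
  by move=> /hr; apply; apply: le_ball px; lra.
have cp : ~ curve G (edge s t) p by move=> /hr; apply; exact: ballxx.
have [cLx eLx] := edge_liftP ste cx; have [cLp eLp] := edge_liftP ste cp.
have pos_cos z : curve G (edge s t) z -> 0 < cos (angle_from x z - angle_from p z).
  by move=> /hr; exact: cos_angle_fromB_near px.
have ca : {within curve G (edge s t), continuous (shift_angle x p)}.
  apply: (@continuous_principal _ _ _ (fun z => angle_from x z - angle_from p z)) => //.
  by apply: angular_continuousB; exact: angular_continuous_angle_from.
pose psi z := edge_lift x (edge s t) z - edge_lift p (edge s t) z - shift_angle x p z.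
have : psi (pos G s) = psi (pos G t).
  apply: (continuous_eqangle0_cst (A := curve G (edge s t))).
  - exact: arc_connected (edge_is_arc st).
  - by move=> z; apply: cvgB; [apply: cvgB; [exact: cLx|exact: cLp]|exact: ca].
  - move=> z sz; rewrite -(subrr (angle_from x z - angle_from p z)).
    apply: eqangleB; first by apply: eqangleB; [exact: eLx|exact: eLp].
    exact/eqangle_principal/pos_cos.
  - by apply: curve_end => //; rewrite !inE eqxx.
  - by apply: curve_end => //; rewrite !inE eqxx orbT.
by rewrite /psi /edge_turn; lra.
Qed.

(* The edge leaving [s] is discarded so that [p] may lie on it. *)
Lemma winding_shift c s x p (r : R) : is_cycle G c -> s \in c ->
  (forall t, t \in c -> t != s -> forall z, curve G (edge t (next c t)) z ->
     ~ ball p r z) -> ball p (r / 2) x ->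
  (winding c x - edge_turn x s (next c s)) -
  (winding c p - edge_turn p s (next c s)) =
  shift_angle x p (pos G s) - shift_angle x p (pos G (next c s)).
Proof.
move=> cc sc hr px; have uc := cycle_uniq cc.
(* The shift angles cancel around the whole cycle, so the other edges contribute the opposite of the
   term at [s]. *)
have := sum_next (fun t => shift_angle x p (pos G t)) uc.
move/eqP; rewrite -subr_eq0 -sumrB (bigD1_seq s)//= => /eqP.
have -> : \sum_(t <- c | t != s) (shift_angle x p (pos G (next c t)) -
    shift_angle x p (pos G t)) = \sum_(t <- c | t != s)
    (edge_turn x t (next c t) - edge_turn p t (next c t)).
  rewrite big_seq_cond [RHS]big_seq_cond; apply: eq_bigr => t /andP[tc ts].
  by rewrite (edge_turn_shift (r := r))//; [exact: cycle_erel|exact: hr].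
rewrite /winding !(bigD1_seq s sc uc)/= sumrB; lra.
Qed.

(** A ball inside the face misses every edge, so a small move changes nothing: [edge_turn_shift]
    restores the edge discarded by [winding_shift]. *)
Lemma winding_face_cst c f x y : is_cycle G c -> face G f -> f x -> f y ->
  winding c x = winding c y.
Proof.
move=> cc ff; apply: locally_constant_cst; [exact: face_open|exact: face_connected|].
move=> {x y} p fp.
have /nbhs_ballP[r /= r0 hr] : nbhs p f.
  by apply: open_nbhs_nbhs; split => //; exact: face_open.
apply/nbhs_ballP; exists (r / 2); first by rewrite /= divr_gt0.
move=> x px.
have hz t : t \in c -> forall z, curve G (edge t (next c t)) z -> ~ ball p r z.
  move=> tc z tz /hr fz; apply: (face_avoids_curve ff fz _ tz).
  exact: cycle_edges_edge (mem_cycle_edges tc).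
have [s sc] : exists s, s \in c.
  by case/andP : (cc) => _; case: (c) => // s c' _; exists s; rewrite inE eqxx.
have := winding_shift cc sc (fun t tc _ => hz t tc) px.
have := edge_turn_shift (cycle_erel cc sc) (hz s sc) px.
lra.
Qed.

(* [p] is a point of the shared edge; near it lie points [x] of [f] and [y] of
   [g], and moving from [x] to [y] changes the winding number of either cycle
   by the jump of the turn of the shared edge alone. *)
Lemma winding_across_edge c c' f g A : bounds G c f -> bounds G c' g ->
  f <> g -> A \in edge_set G ->
  curve G A `<=` frontier f -> curve G A `<=` frontier g ->
  exists s s', [/\ s \in c, s' \in c',
    A = edge s (next c s), A = edge s' (next c' s') &
    forall x y, f x -> g y ->
      winding c x = if s == s' then - winding c' y else winding c' y].
Proof.
move=> bf bg fg Ae Af Ag.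
have [cc [ff _] fr] := bf; have [cc' [fg' _] gr] := bg.
have [p [Ap pv pB]] := curve_midpoint Ae.
have Amem d h : bounds G d h -> curve G A `<=` frontier h ->
    exists2 s, s \in d & A = edge s (next d s).
  move=> [dd _ hd] /(_ _ Ap); rewrite hd curvesE => -[B /= Bd Bp].
  have [BA|BA] := eqVneq B A; last first.
    by case: (pB B) => //; exact: cycle_edges_edge Bd.
  by apply/cycle_edgesP; rewrite -BA.
have [s sc eA] := Amem c f bf Af; have [s' sc' eA'] := Amem c' g bg Ag.
exists s, s'; split => // x0 y0 fx0 gy0.
(* All edges but the shared one: a small ball around [p] misses them. *)
pose C := \bigcup_(B in [set B | (B \in edge_set G) && (B != A)]) curve G B.
have clC : closed C.
  apply: closed_bigcup; first exact: finite_finset.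
  by move=> B /= /andP[Be _]; exact: curve_closed.
have /nbhs_ballP[r /= r0 hr] : nbhs p (~` C).
  apply: open_nbhs_nbhs; split; first exact: closed_openC.
  by move=> [B /= /andP[Be BA]]; exact: pB.
have near_face h : curve G A `<=` frontier h -> exists2 x, h x & ball p (r / 2) x.
  move=> Ah; have [hp _] : frontier h p by exact: Ah.
  have [x [hx px]] := hp _ (nbhsx_ballx p (r / 2) (divr_gt0 r0 (ltr0Sn _ 1))).
  by exists x.
have [x fx px] := near_face f Af; have [y gy py] := near_face g Ag.
have off d t u : is_cycle G d -> t \in d -> A = edge t (next d t) -> u \in d -> u != t ->
    forall z, curve G (edge u (next d u)) z -> ~ ball p r z.
  move=> dd td eAd ud ut z uz /hr; apply; exists (edge u (next d u)) => //=.
  rewrite (cycle_edges_edge dd (mem_cycle_edges ud))/= eAd.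
  by apply: contra ut => /eqP/(cycle_edge_inj dd ud td)->.
have hx := winding_shift cc sc (fun t => off c s t cc sc eA) px.
have hy := winding_shift cc sc (fun t => off c s t cc sc eA) py.
have hx' := winding_shift cc' sc' (fun t => off c' s' t cc' sc' eA') px.
have hy' := winding_shift cc' sc' (fun t => off c' s' t cc' sc' eA') py.
have gf : g <> f by move=> e; apply: fg.
have cgx : ~ closure g x := faces_closure_disjoint fg' ff gf fx.
have cfy : ~ closure f y := faces_closure_disjoint ff fg' fg gy.
(* Each winding number vanishes on the other region, so its jump between [x] and [y] is its inner
   value up to sign. *)
have w1 := winding_outside bf fx cfy.
have w2 := winding_outside bg gy cgx.
rewrite (winding_face_cst cc ff fx0 fx) (winding_face_cst cc' fg' gy0 gy).
have e : edge s (next c s) = edge s' (next c' s') by rewrite -eA -eA'.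
move: hx hy hx' hy'; rewrite w1 w2.
(* Equal starting vertices mean the same direction and equal jumps; otherwise the edge is reversed
   and the jump changes sign. *)
have [ss|ss] := eqVneq s s'.
  have -> : next c' s' = next c s.
    have : next c' s' \in edge s (next c s) by rewrite e !inE eqxx orbT.
    rewrite !inE => /orP[/eqP n|/eqP//].
    by have := cycle_erel cc' sc'; rewrite n -ss erel_irr.
  rewrite -ss; lra.
have e1 : next c s = s'.
  have : s' \in edge s (next c s) by rewrite e !inE eqxx.
  by rewrite !inE => /orP[/eqP n|/eqP//]; rewrite n eqxx in ss.
have e2 : next c' s' = s.
  have : s \in edge s' (next c' s') by rewrite -e !inE eqxx.
  by rewrite !inE => /orP[/eqP n|/eqP//]; rewrite n eqxx in ss.
rewrite e1 e2 !(edge_turnC _ s s'); lra.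
Qed.

End PlaneGraphWinding.

(** * Alternating cycles *)

Section Alternation.
Variables (R : realType) (T : finType) (G : plane_graph R T).
Variables (color : T -> bool) (S : {set T}) (M : {set {set T}}).
Hypotheses (color_edge : forall u v, erel G u v -> color u <> color v).
Hypothesis (pM : perfect_matching G S M).

Local Notation edge s t := (finset.setU (finset.set1 s) (finset.set1 t)).

Lemma color_next c s : is_cycle G c -> s \in c ->
  color (next c s) = ~~ color s.
Proof.
move=> cc sc; have := color_edge (cycle_erel cc sc).
by case: (color s); case: (color _).
Qed.

Lemma color_nth s0 c i : is_cycle G (s0 :: c) -> (i < (size c).+1)%N ->
  color (nth s0 (s0 :: c) i) = odd i (+) color s0.
Proof.
move=> cc; elim: i => [|i IH] ic //.
have ic' : (i < size (s0 :: c))%N by exact: ltnW.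
have -> : nth s0 (s0 :: c) i.+1 = next (s0 :: c) (nth s0 (s0 :: c) i).
  by rewrite next_nth_cons ?(cycle_uniq cc).
by rewrite color_next ?mem_nth// IH ?(ltnW ic)//= addNb.
Qed.

Lemma matching_disjoint A B s : A \in M -> B \in M -> s \in A -> s \in B -> A = B.
Proof.
move=> AM BM sA sB; apply: contrapT => /eqP AB.
have /andP[_ /and3P[_ /finset.trivIsetP tM _]] := pM.
by have := tM _ _ AM BM AB; rewrite finset.disjoints_subset => /fintype.subsetP/(_ s sA); rewrite inE sB.
Qed.

Lemma alternating_color c : is_cycle G c -> Defs.alternating M c ->
  exists k, forall s, s \in c -> (edge s (next c s) \in M) = (color s == k).
Proof.
case: c => [|s0 c] // cc [b hb].
set C := s0 :: c in cc hb *.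
have uC : uniq C := cycle_uniq cc.
have inM s : s \in C -> odd (index s C) = b -> edge s (next C s) \in M.
  move=> sC ob; have iC : (index s C < size C)%N by rewrite index_mem.
  have := hb _ iC ob.
  by rewrite (nth_map s0)// nth_index.
have odd_color s : s \in C -> color s = odd (index s C) (+) color s0.
  move=> sC; have iC : (index s C < size C)%N by rewrite index_mem.
  by rewrite -{1}(nth_index s0 sC) color_nth.
(* The colour of the vertices at positions of parity [b]. *)
exists (b (+) color s0) => s sC.
rewrite (odd_color _ sC) (can_eq (addbK _)).
have [ob|ob] := eqVneq (odd (index s C)) b; first by rewrite inM.
(* A matching edge at a position of the other parity would share a vertex with the next edge, which
   is selected. *)
apply/negP => sM.
have nC : next C s \in C by rewrite mem_next.
have nM : edge (next C s) (next C (next C s)) \in M.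
  apply: inM => //.
  (* Reading parities off the colours also covers the wrap from the last vertex to the first. *)
  have := color_next cc sC; rewrite (odd_color _ nC) (odd_color _ sC).
  by move: ob; case: (odd (index s C)); case: (odd _); case: (b); case: (color s0).
have := matching_disjoint (s := next C s) sM nM.
rewrite !inE eqxx orbT => /(_ isT isT) /(cycle_edge_inj cc sC nC) e.
by have := erel_irr G s; rewrite {2}e cycle_erel.
Qed.

End Alternation.

(** * The two-colouring of the face graph *)

Theorem theorem2p3 (R : realType) (T : finType) (G : plane_graph R T)
    (F : {set {set T}} * {set {set {set T}}}) :
  bipartite (underlying G) ->
  (exists M : {set {set T}}, perfect_matching G finset.setT M) ->
  cubical_face G F ->
  bipartite (face_graph G F).
Proof.
move=> [color hcolor] _ [_ _ pM].
have color_edge u v : erel G u v -> color u <> color v.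
  by move=> uv; apply: hcolor.
(* Each region gets a bounding cycle, the colour of the vertices that its matching edges leave, and
   an inner point. *)
pose data (f : set (R * R)) (d : seq T * bool * (R * R)) :=
  [/\ bounds G d.1.1 f,
    forall s, s \in d.1.1 -> ([set s; next d.1.1 s]%SET \in F.1) = (color s == d.1.2) &
    f d.2].
have dataP f : alternating_regions G F f -> exists d, data f d.
  move=> [c [bc ac]]; have [cc [ff _] _] := bc.
  have [k hk] := alternating_color color_edge pM cc ac.
  by have [x fx] := face_nonempty ff; exists (c, k, x).
pose d f := xget ([::], false, (0, 0)) (data f).
have dP f : alternating_regions G F f -> data f (d f).
  by move=> /dataP; exact: xgetPex.
exists (fun f => (0 < winding G (d f).1.1 (d f).2) (+) (d f).1.2).
move=> f g _ _ [Sf Sg [fg [A [Ae Af Ag]]]].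
move: (dP f Sf) (dP g Sg); case: (d f) => -[c k] x; case: (d g) => -[c' k'] y.
move=> [/= bf hk fx] [/= bg hk' gy].
have [s [s' [sc sc' eA eA' /(_ x y fx gy)]]] := winding_across_edge bf bg fg Ae Af Ag.
have [cc [ff _] _] := bf; have [cc' [fg' _] _] := bg.
have cfy : ~ closure f y by apply: (faces_closure_disjoint ff fg' fg gy).
have gf : g <> f by move=> e; apply: fg.
have cgx : ~ closure g x by apply: (faces_closure_disjoint fg' ff gf fx).
have wf := winding_inside bf fx cfy; have wg := winding_inside bg gy cgx.
(* The shared edge is in the matching or not for both cycles at once, which ties [k] and [k'] to the
   colours of [s] and [s']. *)
have := hk s sc; have := hk' s' sc'; rewrite -eA -eA' => -> kk.
have [ss|ss] := eqVneq s s' => ww.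
  have -> : k = k'.
    by move: kk; rewrite ss; case: (color s'); case: (k); case: (k').
  rewrite ww oppr_gt0.
  (* Negation flips the sign only because the winding number is nonzero. *)
  by move: wg; case: ltgtP => // _ _; case: (k').
have e : color s = ~~ color s'.
  have : s' \in [set s; next c s]%SET by rewrite -eA eA' !inE eqxx.
  rewrite !inE eq_sym (negPf ss) => /eqP ->.
  by rewrite (color_next color_edge)// negbK.
have -> : k = ~~ k'.
  by move: kk; rewrite e; case: (color s'); case: (k); case: (k').
by rewrite ww; case: (0 < _); case: (k').
Qed.
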